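(* For every planar binary rooted tree $T$ with $|T|\ge2$ leaves and every integer $k\ge0$, \[ (-1)^{r_T-1}P(T)(k+1)=\sum_{d=0}^{|T|-2}\binom{|T|-1+k-d}{|T|-1}E(T,d), \] where binomial coefficients are generalized ones, so $\binom{|T|-1+k-d}{|T|-1}=0$ when $k<d$.
   Context: Over a field of characteristic zero. Planar binary rooted trees have a univalent root; $|$ is the one-leaf tree; edges to right (left) children are right (left) pointing, the root edge counts as right pointing; $r_T$ is the number of right pointing leaves. For an edge $e$ of $T'$, $T\searrow_eT'$ subdivides $e$ by a new vertex with right child the part of $T'$ above $e$ and left child $T$; $T\rhd T'=\sum_{e\text{ right}}T\searrow_eT'-\sum_{e\text{ left}}T\searrow_eT'$ on $\mathcal{T}_{\mathrm{pb}}=\prod_n\mathcal{T}_{\mathrm{pb}}(n)$. $P=\sum_TP(T)(t)T$ is the solution of $P'=\langle\frac{D}{1-e^{-D}}|P\rangle\rhd P$, $P(0)=|$, with $\langle\frac{D}{1-e^{-D}}|\cdot\rangle$ the functional $t^n\mapsto(-1)^nB_n$ ($B_n$ Bernoulli numbers) applied coefficientwise. Admissible labeling $\ell$ of the leaves by $\{1,\ldots,|T|\}$: injective, and for every inner vertex $v$ the leftmost (rightmost) leaf descending from $v$ has the minimal (maximal) label among those leaves. $\varepsilon(v)=1$ if the inner vertex $v$ is adjacent to the root edge or a right child, $-1$ if a left child; a leaf is removable if it is the left child of $v$ with $\varepsilon(v)=1$ or the right child of $v$ with $\varepsilon(v)=-1$; removing a leaf deletes it and its parent, attaching the sibling subtree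 in the parent's place. $S(T,\ell)\subset S_{|T|-1}$: permutations $\sigma$ such that for all $i$ the leaf labeled $\sigma(i)$ is removable after removing the leaves labeled $\sigma(1),\ldots,\sigma(i-1)$. $E(T,d)$ is the number of $\sigma\in S(T,\ell)$ with descent number $d_\sigma=|\{i:\sigma(i)>\sigma(i+1)\}|=d$; it is independent of the admissible labeling $\ell$.
   Formalization: For a left pointing edge e, the grafting of T on e makes T the right child and the part above e the left child of the new vertex, instead of T always being the left child; with the literal rule the identity fails for ((|,(|,|)),|), where P would be t/6. *)

(* Defs.v *)
From HB Require Import structures.
From mathcomp Require Import all_boot all_order all_algebra all_fingroup.
From mathcomp Require Import zify.

Set Implicit Arguments.
Unset Strict Implicit.
Unset Printing Implicit Defensive.

Import GRing.Theory.
Local Open Scope ring_scope.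

(* Planar binary rooted trees with leaves labeled in A.  The univalent root is
   implicit: every vertex of the datatype (inner vertex or leaf) stands for the
   edge just below it, the topmost constructor standing for the root edge. *)
Inductive bintree (A : Type) : Type :=
  | Leaf of A
  | Node of bintree A & bintree A.

Notation pbtree := (bintree unit).
Notation leaf := (Leaf tt).

Fixpoint bintree_eqb (A : eqType) (T U : bintree A) : bool :=
  match T, U with
  | Leaf a, Leaf b => a == b
  | Node l r, Node l' r' => bintree_eqb l l' && bintree_eqb r r'
  | _, _ => false
  end.

Lemma bintree_eqP (A : eqType) : Equality.axiom (@bintree_eqb A).
Proof.
elim=> [a|l IHl r IHr] [b|l' r'] /=; try by constructor.
  by apply: (iffP eqP) => [->|[->]].
by apply: (iffP andP) => [[/IHl -> /IHr ->]|[<- <-]] //; split; [apply/IHl|apply/IHr].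
Qed.

HB.instance Definition _ (A : eqType) :=
  hasDecEq.Build (bintree A) (@bintree_eqP A).

Fixpoint leaves (A : Type) (T : bintree A) : seq A :=
  match T with
  | Leaf a => [:: a]
  | Node l r => leaves l ++ leaves r
  end.

Definition nleaves (A : Type) (T : bintree A) : nat := size (leaves T).

Fixpoint shape (A : Type) (T : bintree A) : pbtree :=
  match T with
  | Leaf _ => leaf
  | Node l r => Node (shape l) (shape r)
  end.

(* In all functions below with an argument [right : bool], it is the direction
   of the edge under the current subtree; it is [true] for the root edge. *)
Fixpoint right_leaves_from (right : bool) (T : pbtree) : nat :=
  match T with
  | Leaf _ => right
  | Node l r => (right_leaves_from false l + right_leaves_from true r)%N
  end.

Definition right_leaves (T : pbtree) : nat := right_leaves_from true T.

(* All graftings of T on an edge e of U, each with the direction of e.  The new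
   vertex subdividing e has T on its left if e is right pointing and T on its
   right if e is left pointing, so that the part of U above e keeps its
   direction.  (Grafting T on the left of left pointing edges too would not give
   a pre-Lie product, and the coefficient of ((|,(|,|)),|) in P would be t/6.) *)
Fixpoint graftings (right : bool) (T U : pbtree) : seq (bool * pbtree) :=
  (right, if right then Node T U else Node U T) ::
  match U with
  | Leaf _ => [::]
  | Node l r =>
      [seq (x.1, Node x.2 r) | x <- graftings false T l] ++
      [seq (x.1, Node l x.2) | x <- graftings true T r]
  end.

Section PreLie.
Variable R : nzRingType.

(* The coefficient of V in T |> U. *)
Definition prelie_coef (T U V : pbtree) : R :=
  \sum_(x <- graftings true T U | x.2 == V) (if x.1 then 1 else -1).

Fixpoint trees_rec (fuel n : nat) : seq pbtree :=
  if fuel is fuel'.+1 then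
    if n == 1%N then [:: leaf] else
    flatten [seq [seq Node l r | l <- trees_rec fuel' i,
                                 r <- trees_rec fuel' (n - i)%N]
            | i <- iota 1 n.-1]
  else [::].

(* The trees with n leaves, each once: see [mem_trees] and [trees_uniq]. *)
Definition trees (n : nat) : seq pbtree := trees_rec n n.

(* The product on the completed space: an element is the family of its
   coefficients.  T1 |> T2 is homogeneous of degree |T1| + |T2|, whence the
   finite sum. *)
Definition prelie (a b : pbtree -> R) (V : pbtree) : R :=
  \sum_(i < (nleaves V).+1)
    \sum_(T1 <- trees i) \sum_(T2 <- trees (nleaves V - i)%N)
      a T1 * b T2 * prelie_coef T1 T2 V.

End PreLie.

Section Solution.
Variable K : fieldType.

(* The list B_0, ..., B_(n-1) of Bernoulli numbers, with B_1 = - 1/2. *)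
Fixpoint bernoulli_seq (n : nat) : seq K :=
  if n is m.+1 then
    let s := bernoulli_seq m in
    rcons s (((m == 0%N)%:R - \sum_(j < m) 'C(m.+1, j)%:R * s`_j) / m.+1%:R)
  else [::].

Definition bernoulli (n : nat) : K := (bernoulli_seq n.+1)`_n.

(* The functional < D / (1 - exp(- D)) | p >. *)
Definition todd (p : {poly K}) : K :=
  \sum_(n < size p) p`_n * ((-1) ^+ n * bernoulli n).

Definition is_solution (P : pbtree -> {poly K}) : Prop :=
  (forall T, (P T)^`() = prelie (fun U => (todd (P U))%:P) P T) /\
  (forall T, (P T).[0] = (T == leaf)%:R).

End Solution.

(* For every inner vertex, the leftmost (rightmost) leaf above it has the
   minimal (maximal) label among the leaves above it. *)
Fixpoint extremal_ends (L : bintree nat) : bool :=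
  match L with
  | Leaf _ => true
  | Node l r =>
      [&& all (fun a => head 0%N (leaves L) <= a <= last 0%N (leaves L))%N
            (leaves L),
          extremal_ends l & extremal_ends r]
  end.

(* A labeling of T is a labeled tree of shape T. *)
Definition admissible (T : pbtree) (L : bintree nat) : bool :=
  [&& shape L == T, uniq (leaves L),
      all (fun a => 1 <= a <= nleaves T)%N (leaves L) & extremal_ends L].

(* [right] encodes the sign epsilon of the current inner vertex. *)
Fixpoint removable_from (right : bool) (a : nat) (L : bintree nat) : bool :=
  match L with
  | Leaf _ => false
  | Node l r =>
      [|| (if right then l else r) == Leaf a,
          removable_from false a l | removable_from true a r]
  end.

Definition removable (a : nat) (L : bintree nat) : bool :=
  removable_from true a L.

Fixpoint remove_leaf (L : bintree nat) (a : nat) : bintree nat :=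
  match L with
  | Leaf _ => L
  | Node l r =>
      if l == Leaf a then r else if r == Leaf a then l
      else Node (remove_leaf l a) (remove_leaf r a)
  end.

(* One-line notation; s permutes 'I_n = {0, ..., n-1}, hence the shift by 1. *)
Definition perm_word (n : nat) (s : {perm 'I_n}) : seq nat :=
  [seq (s i : nat).+1 | i <- enum 'I_n].

Definition removal_perms (L : bintree nat) : {set {perm 'I_(nleaves L).-1}} :=
  [set s : {perm 'I_(nleaves L).-1} |
    [forall i : 'I_(nleaves L).-1,
      removable (s i).+1 (foldl remove_leaf L (take i (perm_word s)))]].

Definition descents (n : nat) (s : {perm 'I_n}) : nat :=
  #|[set i : 'I_n | [exists j : 'I_n, (j == i.+1 :> nat) && (s j < s i)%N]]|.

(* E(T, d), computed from the labeling L of T. *)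
Definition eulerian_count (L : bintree nat) (d : nat) : nat :=
  #|[set s in removal_perms L | descents s == d]|.

Lemma nleaves_gt0 (A : Type) (T : bintree A) : (0 < nleaves T)%N.
Proof.
by rewrite /nleaves; elim: T => //= l IHl r _; rewrite size_cat ltn_addr.
Qed.

Lemma nleaves_node (A : Type) (l r : bintree A) :
  nleaves (Node l r) = (nleaves l + nleaves r)%N.
Proof. by rewrite /nleaves size_cat. Qed.

Lemma mem_trees_rec fuel n (T : pbtree) :
  (n <= fuel)%N -> (T \in trees_rec fuel n) = (nleaves T == n).
Proof.
elim: fuel n T => [|f IH] n T /= lenf.
  rewrite in_nil; apply/esym/negbTE.
  by have := nleaves_gt0 T; lia.
case: eqP => [->|n1].
  case: T => [[]|l r]; rewrite inE // nleaves_node.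
  apply/esym/negbTE.
  by have := nleaves_gt0 l; have := nleaves_gt0 r; lia.
apply/flatten_mapP/eqP => [[i]|].
  rewrite mem_iota => ilt /allpairsP[[l r] /= [lin rin ->]].
  move: lin rin; rewrite !IH; try lia.
  by rewrite nleaves_node => /eqP el /eqP er; lia.
case: T => [[]|l r] e; first by case: n1.
move: e; rewrite nleaves_node => e.
have l0 := nleaves_gt0 l; have r0 := nleaves_gt0 r.
exists (nleaves l); first by rewrite mem_iota; lia.
by apply/allpairsP; exists (l, r); split=> //=; rewrite IH; lia.
Qed.

Lemma mem_trees n (T : pbtree) : (T \in trees n) = (nleaves T == n).
Proof. exact: mem_trees_rec. Qed.

Lemma trees_rec_uniq fuel n : (n <= fuel)%N -> uniq (trees_rec fuel n).
Proof.
elim: fuel n => [|f IH] n //= lenf; case: eqP => // /eqP n1.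
have sub : {subset iota 1 n.-1 <= [pred i | (i <= f)%N && (n - i <= f)%N]}.
  by move=> i; rewrite mem_iota inE; lia.
elim: (iota _ _) (iota_uniq 1 n.-1) sub => //= i s IHs /andP[nis us] sub.
have /andP[hi hni] := sub i (mem_head _ _).
have sub' : {subset s <= [pred i | (i <= f)%N && (n - i <= f)%N]}.
  by move=> j js; apply: sub; rewrite inE js orbT.
rewrite cat_uniq IHs // andbT allpairs_uniq ?IH //=; last first.
  by move=> [? ?] [? ?] _ _ /= [-> ->].
apply/hasPn => T /flatten_mapP[j js /allpairsP[[l r] /= [lin _ ->]]].
apply/negP => /allpairsP[[l' r'] /= [lin' _ [e _]]].
have /andP[hj _] := sub' j js.
move: lin lin'; rewrite !mem_trees_rec // -e => /eqP -> /eqP ji.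
by rewrite -ji js in nis.
Qed.

Lemma trees_uniq n : uniq (trees n).
Proof. exact: trees_rec_uniq. Qed.

Lemma size_bernoulli_seq (K : fieldType) n : size (bernoulli_seq K n) = n.
Proof. by elim: n => //= n IH; rewrite size_rcons IH. Qed.

Lemma nth_bernoulli_seq (K : fieldType) n j :
  (j < n)%N -> (bernoulli_seq K n)`_j = bernoulli K j.
Proof.
elim: n => // n IH; rewrite ltnS leq_eqVlt => /orP[/eqP -> //|jn].
by rewrite /= nth_rcons size_bernoulli_seq jn IH.
Qed.

Lemma bernoulliE (K : fieldType) (charK : [pchar K] =i pred0) n :
  \sum_(j < n.+1) 'C(n.+1, j)%:R * bernoulli K j = (n == 0%N)%:R.
Proof.
have n0 : n.+1%:R != 0 :> K by move/pcharf0P: charK => ->.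
rewrite big_ord_recr /= binSn [X in _ + _ * X]/bernoulli /=.
rewrite nth_rcons size_bernoulli_seq ltnn eqxx mulrCA divff // mulr1.
rewrite addrC -[RHS]addr0 -addrA; congr (_ + _); apply/eqP.
rewrite addrC subr_eq0; apply/eqP/eq_bigr => j _.
by rewrite nth_bernoulli_seq.
Qed.

Lemma prelie_ext (R : nzRingType) (a a' b b' : pbtree -> R) V :
    (forall T, (nleaves T < nleaves V)%N -> a T = a' T /\ b T = b' T) ->
  prelie a b V = prelie a' b' V.
Proof.
move=> e; apply: eq_bigr => i _; apply: eq_big_seq => T1.
rewrite mem_trees => /eqP n1; apply: eq_big_seq => T2.
rewrite mem_trees => /eqP n2.
have iV : (i <= nleaves V)%N by rewrite -ltnS.
have n12 : (nleaves T1 + nleaves T2 = nleaves V)%N by rewrite n1 n2 subnKC.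
have [-> _] : a T1 = a' T1 /\ b T1 = b' T1.
  by apply: e; rewrite -n12 -[X in (X < _)%N]addn0 ltn_add2l nleaves_gt0.
have [_ -> //] : a T2 = a' T2 /\ b T2 = b' T2.
by apply: e; rewrite -n12 -[X in (X < _)%N]add0n ltn_add2r nleaves_gt0.
Qed.

Section ExistsUnique.
Variables (K : fieldType) (charK : [pchar K] =i pred0).

Let natrK_neq0 n : n.+1%:R != 0 :> K.
Proof. by move/pcharf0P: charK => ->. Qed.

Let prim (p : {poly K}) : {poly K} :=
  \poly_(i < (size p).+1) (if i is j.+1 then p`_j / j.+1%:R else 0).

Let deriv_prim p : (prim p)^`() = p.
Proof.
apply/polyP => i; rewrite coef_deriv coef_poly ltnS.
case: ltnP => [_|hi]; last by rewrite mul0rn nth_default.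
by rewrite -[LHS]mulr_natr divfK.
Qed.

Let horner0_prim p : (prim p).[0] = 0.
Proof. by rewrite horner_coef0 coef_poly. Qed.

Let deriv_inj (p q : {poly K}) : p^`() = q^`() -> p.[0] = q.[0] -> p = q.
Proof.
move=> e; rewrite !horner_coef0 => e0; apply/polyP => -[|i] //.
move/polyP/(_ i): e; rewrite !coef_deriv -[LHS]mulr_natr -[RHS]mulr_natr.
by move/(mulIf (natrK_neq0 i)).
Qed.

Lemma is_solution_unique (P Q : pbtree -> {poly K}) :
  is_solution P -> is_solution Q -> P =1 Q.
Proof.
move=> [dP P0] [dQ Q0] T.
have [n] := ubnP (nleaves T); elim: n T => // n IH T.
rewrite ltnS => Tn; apply: deriv_inj; last by rewrite P0 Q0.
rewrite dP dQ; apply: prelie_ext => U UT.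
by rewrite IH // (leq_trans UT).
Qed.

Let step (P : pbtree -> {poly K}) T : {poly K} :=
  (T == leaf)%:R + prim (prelie (fun U => (todd (P U))%:P) P T).

Lemma is_solution_exists : exists P : pbtree -> {poly K}, is_solution P.
Proof.
pose Q n := iter n step (fun=> 0).
have stable m n T : (nleaves T <= m)%N -> (nleaves T <= n)%N -> Q m T = Q n T.
  elim: m n T => [|m IH] [|n] T Tm Tn; try by have := nleaves_gt0 T; lia.
  rewrite /= /step; congr (_ + prim _); apply: prelie_ext => U UT.
  rewrite -!/(Q _) (IH n) // -ltnS; exact: leq_trans UT _.
exists (fun T => Q (nleaves T) T); split=> T.
  rewrite -(prednK (nleaves_gt0 T)) /= derivD deriv_prim.
  have -> : ((T == leaf)%:R : {poly K})^`() = 0.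
    by case: eqP; rewrite ?deriv0 // derivC.
  rewrite add0r; apply: prelie_ext => U UT.
  have e : Q (nleaves T).-1 U = Q (nleaves U) U.
    by apply: stable => //; rewrite -ltnS prednK ?nleaves_gt0.
  by rewrite -/(Q _) e.
rewrite -(prednK (nleaves_gt0 T)) /= hornerD horner0_prim addr0.
by case: eqP => _; rewrite ?hornerC ?horner0.
Qed.

End ExistsUnique.

Fixpoint planar_labeling (m : nat) (T : pbtree) : bintree nat :=
  match T with
  | Leaf _ => Leaf m
  | Node l r =>
      Node (planar_labeling m l) (planar_labeling (m + nleaves l)%N r)
  end.

Lemma leaves_planar m T : leaves (planar_labeling m T) = iota m (nleaves T).
Proof. by elim: T m => //= l IHl r IHr m; rewrite IHl IHr nleaves_node iotaD. Qed.

Lemma admissible_exists T : exists L, admissible T L.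
Proof.
exists (planar_labeling 1 T); rewrite /admissible leaves_planar iota_uniq.
apply/and4P; split=> //.
- apply/eqP; elim: T 1%N => [[]|l IHl r IHr] m //=.
  by rewrite IHl IHr.
- by apply/allP => i; rewrite mem_iota add1n ltnS.
elim: T 1%N => //= l IHl r IHr m; rewrite IHl IHr !andbT !leaves_planar.
rewrite -iotaD -nleaves_node; apply/allP => i; rewrite mem_iota.
case: (nleaves _) => [|n]; first by rewrite addn0; case: ltngtP.
move=> /andP[-> /=]; rewrite addnS ltnS.
have -> // : last m (iota m.+1 n) = (m + n)%N.
by elim: n m => [|n IHn] m //=; rewrite ?addn0 // IHn addnS.
Qed.

(* Main.v *)
From HB Require Import structures.
Require Import Defs.
From mathcomp Require Import all_boot all_order all_algebra all_fingroup.
From mathcomp Require Import ring zify.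

Set Implicit Arguments.
Unset Strict Implicit.
Unset Printing Implicit Defensive.

Import GRing.Theory.
Local Open Scope ring_scope.

(* Call the left child of a right pointing inner vertex, and the right child of
   a left pointing one, its removable child.  The inner vertices of T form a
   plane forest: the children of v are the vertices on the spine that starts at
   its removable child and keeps the direction of that child.  A grafting of
   T1 on an edge of U makes T1 the removable child of the new vertex, and each
   v is removed together with one fixed leaf (the far end of that spine), once
   all its descendants are gone.  So S(T, l) consists of the linear extensions
   of the forest, and an admissible labeling makes the edges of the forest strict
   or weak according to the sign of the parent.  By the theory of
   P-partitions, the right-hand side counts the maps from the forest to
   {0, ..., k} which increase from children to parents, strictly below right
   pointing vertices.

   Up to sign, these counts are values of polynomials obtained by iterating
   products and discrete antiderivatives with respect to the backward
   difference p(t) - p(t - 1).  The Todd functional sends the backward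
   difference of S to S'(0), hence measures the failure of the antiderivative
   to commute with d/dt; together with the product rule this shows that the
   polynomials solve the differential equation, whose solution is unique. *)

(** * Backward difference, Todd functional and discrete antiderivative *)

Section BackwardDifference.
Variable K : fieldType.
Implicit Types p q : {poly K}.

Definition bdiff p : {poly K} := p - (p \Po ('X - 1)).

Fact bdiff_is_linear : linear bdiff.
Proof. by move=> c p q; rewrite /bdiff comp_polyD comp_polyZ scalerBr opprD addrACA. Qed.
HB.instance Definition _ :=
  GRing.isLinear.Build K {poly K} {poly K} *:%R bdiff bdiff_is_linear.

Lemma horner_bdiff p x : (bdiff p).[x] = p.[x] - p.[x - 1].
Proof. by rewrite hornerD hornerN horner_comp !hornerE. Qed.

Lemma deriv_shift p : (p \Po ('X - 1))^`() = (p^`() \Po ('X - 1)).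
Proof. by rewrite deriv_comp derivB derivX -polyC1 derivC subr0 mulr1. Qed.

Lemma deriv_bdiff p : (bdiff p)^`() = bdiff p^`().
Proof. by rewrite /bdiff derivB deriv_shift. Qed.

Lemma bdiffC c : bdiff c%:P = 0.
Proof. by rewrite /bdiff comp_polyC subrr. Qed.

Lemma todd_widen N p : (size p <= N)%N ->
  todd p = \sum_(n < N) p`_n * ((-1) ^+ n * bernoulli K n).
Proof.
move=> pN; rewrite /todd (big_ord_widen N (fun n => p`_n * ((-1) ^+ n * bernoulli K n))) //.
rewrite [RHS](bigID (fun n : 'I_N => (n < size p)%N)) /=.
by rewrite [X in _ + X]big1 ?addr0 // => n; rewrite -leqNgt => h; rewrite nth_default ?mul0r.
Qed.

Fact todd_is_linear : linear_for *%R (@todd K).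
Proof.
move=> c p q; pose N := maxn (size (c *: p + q)) (maxn (size p) (size q)).
rewrite !(@todd_widen N) ?/N ?leq_max ?leqnn ?orbT // mulr_sumr -big_split /=.
by apply: eq_bigr => n _; rewrite coefD coefZ mulrDl mulrA.
Qed.
HB.instance Definition _ :=
  GRing.isLinear.Build K {poly K} K *%R (@todd K) todd_is_linear.

Lemma toddXn n : todd ('X^n : {poly K}) = (-1) ^+ n * bernoulli K n.
Proof.
rewrite /todd size_polyXn big_ord_recr /= coefXn eqxx mul1r big1 ?add0r // => i _.
by rewrite coefXn ltn_eqF ?mul0r.
Qed.

Lemma bdiffXn n : bdiff 'X^n = - \sum_(j < n) (-1) ^+ (n - j) *+ 'C(n, j) *: 'X^j.
Proof.
rewrite /bdiff comp_Xn_poly [_ - 1]addrC exprDn big_ord_recr /= subnn expr0 mul1r.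
rewrite binn mulr1n opprD addrCA subrr addr0; congr (- _); apply: eq_bigr => j _.
by rewrite -scalerMnl -mul_polyC polyC_exp polyCN polyC1.
Qed.

Hypothesis charK : [pchar K] =i pred0.

Let natrK_eq0 n : (n%:R == 0 :> K) = (n == 0%N).
Proof. by move/pcharf0P: charK => ->. Qed.

(** The signs combine to $(-1)^n$ and leave the sum of the Bernoulli recurrence, which vanishes
    unless [n] is 1. *)
Let todd_bdiffXn n : todd (bdiff 'X^n) = ('X^n : {poly K})^`().[0].
Proof.
rewrite bdiffXn linearN linear_sum derivXn hornerMn hornerXn /=.
transitivity (- ((-1) ^+ n * \sum_(j < n) 'C(n, j)%:R * bernoulli K j)).
  rewrite mulr_sumr; congr (- _); apply: eq_bigr => j _.
  by rewrite linearZ /= toddXn -mulr_natr mulrACA -exprD subnK ?(ltnW (ltn_ord _)).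
case: n => [|n] /=; first by rewrite big_ord0 mulr0 oppr0.
rewrite bernoulliE //; case: n => [|n] /=; first by rewrite expr0; ring.
by rewrite mulr0 oppr0 expr0n /= mul0rn.
Qed.

Lemma todd_bdiff p : todd (bdiff p) = p^`().[0].
Proof.
rewrite -[p]coefK poly_def !linear_sum /= horner_sum.
apply: eq_bigr => n _.
by rewrite !linearZ /= todd_bdiffXn hornerZ.
Qed.

(* The derivatives of p are again in the kernel of bdiff, so by todd_bdiff they
   all vanish at 0. *)
Lemma bdiff_eq0 p : bdiff p = 0 -> p = p.[0]%:P.
Proof.
have [n] := ubnP (size p); elim: n p => // n IH p pn dp.
have p'0 : p^`().[0] = 0 by rewrite -todd_bdiff dp linear0.
have [->|p0] := eqVneq p 0; first by rewrite horner0.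
have p' : p^`() = 0.
  rewrite (IH p^`()) ?p'0 //; last by rewrite -deriv_bdiff dp deriv0.
  by rewrite (leq_trans (lt_size_deriv p0)).
apply/polyP => -[|i]; first by rewrite coefC /= horner_coef0.
rewrite coefC /=; move/polyP/(_ i): p'; rewrite coef_deriv coef0 -mulr_natr.
by move/eqP; rewrite mulf_eq0 natrK_eq0 orbF => /eqP.
Qed.

Lemma bdiff_inj p q : bdiff p = bdiff q -> p.[0] = q.[0] -> p = q.
Proof.
move=> e e0; apply/eqP; rewrite -subr_eq0; apply/eqP.
have d0 : bdiff (p - q) = 0 by rewrite linearB /= e subrr.
by rewrite (bdiff_eq0 d0) hornerD hornerN e0 subrr.
Qed.

(** Strong induction: the backward difference of $X^{n+1}$ is $(n+1)X^n$ plus lower terms, whose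
    antidifferences are already known. *)
Let antidiff_exists_Xn n : exists q, bdiff q = 'X^n.
Proof.
have [m] := ubnP n; elim: m n => // m IH n nm.
have [q qE] : exists q, bdiff q = \sum_(j < n) (-1) ^+ (n.+1 - j) *+ 'C(n.+1, j) *: 'X^j.
  elim/big_ind: _ => [|_ _ [q <-] [r <-]|j _]; first by exists 0; rewrite linear0.
    by exists (q + r); rewrite linearD.
  have [|q qE] := IH j; first by rewrite (leq_trans (ltn_ord j)).
  by exists (((-1) ^+ (n.+1 - j) *+ 'C(n.+1, j)) *: q); rewrite linearZ /= qE.
exists (n.+1%:R^-1 *: ('X^(n.+1) + q)); rewrite linearZ linearD /= bdiffXn qE.
rewrite big_ord_recr /= opprD addrAC addNr add0r subSn // subnn expr1 binSn.
rewrite -scaleNr scalerA mulNrn opprK.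
by rewrite mulVf ?scale1r // natrK_eq0.
Qed.

Let antidiff_exists p : exists q, (bdiff q == p) && (q.[0] == 0).
Proof.
suff [q <-] : exists q, bdiff q = p.
  exists (q - q.[0]%:P).
  by rewrite linearB /= bdiffC subr0 hornerD hornerN hornerC subrr !eqxx.
rewrite -[p]coefK poly_def.
elim/big_ind: _ => [|_ _ [q <-] [r <-]|j _]; first by exists 0; rewrite linear0.
  by exists (q + r); rewrite linearD.
by have [q qE] := antidiff_exists_Xn j; exists (p`_j *: q); rewrite linearZ /= qE.
Qed.

Definition antidiff p : {poly K} := xchoose (antidiff_exists p).

Lemma bdiff_antidiff p : bdiff (antidiff p) = p.
Proof. by have /andP[/eqP] := xchooseP (antidiff_exists p). Qed.

Lemma horner0_antidiff p : (antidiff p).[0] = 0.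
Proof. by have /andP[_ /eqP] := xchooseP (antidiff_exists p). Qed.

Fact antidiff_is_linear : linear antidiff.
Proof.
move=> c p q; apply: bdiff_inj; first by rewrite linearP /= !bdiff_antidiff.
by rewrite hornerD hornerZ !horner0_antidiff mulr0 addr0.
Qed.
HB.instance Definition _ :=
  GRing.isLinear.Build K {poly K} {poly K} *:%R antidiff antidiff_is_linear.

(** Both sides have backward difference $p'$, so only their values at 0 are left to compare, and
    [todd_bdiff] gives the constant. *)
Lemma deriv_antidiff p : (antidiff p)^`() = antidiff p^`() + (todd p)%:P.
Proof.
apply: bdiff_inj.
  by rewrite -deriv_bdiff !bdiff_antidiff linearD /= bdiff_antidiff bdiffC addr0.
by rewrite hornerD horner0_antidiff add0r hornerC -todd_bdiff bdiff_antidiff.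
Qed.

Lemma horner_antidiff_nat p n : (antidiff p).[n%:R] = \sum_(x < n) p.[x.+1%:R].
Proof.
elim: n => [|n IH]; first by rewrite big_ord0 horner0_antidiff.
have := horner_bdiff (antidiff p) n.+1%:R.
by rewrite bdiff_antidiff -[in _ - 1]natr1 addrK big_ord_recr -IH /= => ->; rewrite addrC subrK.
Qed.

End BackwardDifference.

(** * Cutting trees, the inverse of grafting *)

(* The triples (d, T, U) such that grafting T on an edge of U of direction d
   gives V: there is one for each inner vertex of V. *)
Fixpoint cuts (right : bool) (V : pbtree) : seq (bool * pbtree * pbtree) :=
  match V with
  | Leaf _ => [::]
  | Node l r =>
      (right, if right then l else r, if right then r else l) ::
      [seq (x.1, Node x.2 r) | x <- cuts false l] ++
      [seq (x.1, Node l x.2) | x <- cuts true r]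
  end.

Lemma nleaves_cuts b V c : c \in cuts b V ->
  (nleaves c.1.2 + nleaves c.2)%N = nleaves V.
Proof.
elim: V b c => //= l IHl r IHr b c; rewrite inE mem_cat nleaves_node.
case/or3P => [/eqP ->|/mapP[x xl ->]|/mapP[x xr ->]] /=.
- by case: b; rewrite // addnC.
- by rewrite -(IHl _ _ xl) nleaves_node addnA.
- by rewrite -(IHr _ _ xr) nleaves_node addnCA.
Qed.

(** A grafting on the root edge of [U] is undone at the root of [V]; one inside a child of [U] keeps
    the other child and is undone inside the corresponding child of [V]. *)
Lemma sum_graftings_cuts (A : nmodType) (F : bool -> A) b T U V :
  \sum_(x <- graftings b T U | x.2 == V) F x.1 =
  \sum_(c <- cuts b V | (c.1.2 == T) && (c.2 == U)) F c.1.1.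
Proof.
elim: V b U => [[]|l IHl r IHr] b U.
  rewrite /= big_nil big1_seq // => x /andP[/eqP xE].
  case: U => [u|ul ur] /=; rewrite !inE ?mem_cat.
    by case: b => /eqP ex; move: xE; rewrite ex.
  case/or3P => [/eqP ex|/mapP[y _ ex]|/mapP[y _ ex]]; move: xE; rewrite ex //.
  by case: b {ex}.
have eqN (x1 x2 y1 y2 : pbtree) :
  (Node x1 x2 == Node y1 y2) = (x1 == y1) && (x2 == y2) by [].
rewrite [cuts _ _]/= big_cons.
(* The grafting on the root edge is common to both shapes of [U], so it is split off before the case
   analysis. *)
have -> : graftings b T U = (b, if b then Node T U else Node U T) ::
    match U with Leaf _ => [::] | Node ul ur =>
      [seq (x.1, Node x.2 ur) | x <- graftings false T ul] ++
      [seq (x.1, Node ul x.2) | x <- graftings true T ur] end by case: U.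
rewrite big_cons /=.
set X := (X in if _ then F b + X else X); set Y := (Y in _ = if _ then F b + Y else Y).
suff -> : X = Y.
  have -> // : ((if b then Node T U else Node U T) == Node l r) =
    ((if b then l else r) == T) && ((if b then r else l) == U).
  case: b {X Y}; rewrite eqN; first by rewrite ![_ == l]eq_sym ![_ == r]eq_sym.
  by rewrite andbC ![_ == l]eq_sym ![_ == r]eq_sym.
rewrite {}/X {}/Y big_cat !big_map.
case: U => [u|ul ur].
  by rewrite big_nil !big_pred0 /= ?addr0 // => x; rewrite andbF.
rewrite big_cat !big_map /=; congr (_ + _).
  under eq_bigl do rewrite eqN; under [RHS]eq_bigl do rewrite eqN.
  have [_|_] := eqVneq ur r; last by rewrite !big_pred0 // => x; rewrite !andbF.
  under eq_bigl do rewrite andbT; under [RHS]eq_bigl do rewrite andbT.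
  exact: IHl.
under eq_bigl do rewrite eqN; under [RHS]eq_bigl do rewrite eqN.
have [_|_] := eqVneq ul l; last by rewrite !big_pred0 // => x; rewrite andbF.
exact: IHr.
Qed.

Lemma big_trees_pred1 (A : nmodType) n (U : pbtree) (F : pbtree -> A) :
  nleaves U = n -> \sum_(T <- trees n | U == T) F T = F U.
Proof.
move=> Un; under eq_bigl do rewrite eq_sym.
rewrite -big_filter filter_pred1_uniq ?trees_uniq ?big_seq1 //.
by rewrite mem_trees Un.
Qed.

(** After exchanging the sums, each cut meets exactly one [i] and one pair of listed trees, the two
    trees it produces. *)
Lemma prelie_cuts (R : nzRingType) (a b : pbtree -> R) V :
  prelie a b V =
  \sum_(c <- cuts true V) a c.1.2 * b c.2 * (if c.1.1 then 1 else -1).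
Proof.
rewrite /prelie.
transitivity (\sum_(i < (nleaves V).+1) \sum_(c <- cuts true V | nleaves c.1.2 == i)
   a c.1.2 * b c.2 * (if c.1.1 then 1 else -1)); last first.
  rewrite (exchange_big_dep predT) //=; apply: eq_big_seq => c /nleaves_cuts cV.
  have lt : (nleaves c.1.2 < (nleaves V).+1)%N by rewrite -cV ltnS leq_addr.
  by rewrite (big_pred1 (Ordinal lt)).
apply: eq_bigr => i _.
transitivity (\sum_(T1 <- trees i) \sum_(T2 <- trees (nleaves V - i)%N)
  \sum_(c <- cuts true V | (c.1.2 == T1) && (c.2 == T2))
     a c.1.2 * b c.2 * (if c.1.1 then 1 else -1)).
  apply: eq_bigr => T1 _; apply: eq_bigr => T2 _.
  rewrite /prelie_coef (sum_graftings_cuts (fun s : bool => if s then 1 else -1)).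
  by rewrite mulr_sumr; apply: eq_bigr => c /andP[/eqP -> /eqP ->].
under eq_bigr do rewrite (exchange_big_dep predT) //=.
rewrite (exchange_big_dep predT) //= [RHS]big_mkcond /=.
apply: eq_big_seq => c /nleaves_cuts cV.
case: eqP => [ci|/eqP ci].
  transitivity (\sum_(T1 <- trees i | c.1.2 == T1)
     a c.1.2 * b c.2 * (if c.1.1 then 1 else -1)); last by rewrite big_trees_pred1.
  rewrite [RHS]big_mkcond; apply: eq_bigr => T1 _.
  case: eqP => _ /=; last by rewrite big_pred0.
  by rewrite big_trees_pred1 //; apply: (@addnI i); rewrite subnKC -1?ltnS // -[in LHS]ci.
rewrite big1_seq // => T1 /andP[_]; rewrite mem_trees => /eqP T1i.
rewrite big_pred0 // => T2; case: eqP => // e.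
by rewrite e T1i eqxx in ci.
Qed.

(** * The polynomial solution of the differential equation *)

Section SpinePolynomials.
Variables (K : fieldType) (charK : [pchar K] =i pred0).
Local Notation antidiff := (antidiff charK).

(* The shift in the first case makes the values sums over 0 <= x < n, that is,
   a right pointing vertex is strictly above its children, which are the
   vertices on the left spine of l; in the second case the sums are over
   1 <= x <= n. *)
Fixpoint spine_poly (right : bool) (T : pbtree) : {poly K} :=
  match T with
  | Leaf _ => 1
  | Node l r =>
      if right then antidiff (spine_poly false l \Po ('X - 1)) * spine_poly true r
      else - antidiff (spine_poly true r) * spine_poly false l
  end.

(* A standalone tree has a right pointing root edge, but as the left child of a
   vertex it enters spine_poly with the opposite direction; the functional does
   not see the difference, by a discrete integration by parts. *)
Lemma todd_spine_poly T :
  todd (spine_poly true T) = todd (spine_poly false T \Po ('X - 1)).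
Proof.
case: T => [[]|l r] /=; first by rewrite -polyC1 comp_polyC.
set f := spine_poly false l; set g := spine_poly true r.
set F := antidiff (f \Po _); set G := antidiff g.
have gE : g = G - (G \Po ('X - 1)) by rewrite -[LHS](bdiff_antidiff charK).
have fE : f \Po ('X - 1) = F - (F \Po ('X - 1)) by rewrite -[LHS](bdiff_antidiff charK).
apply/eqP; rewrite -subr_eq0 -linearB /=.
have -> : F * g - ((- G * f) \Po ('X - 1)) = bdiff (F * G).
  by rewrite comp_polyM [(- G) \Po _]raddfN /= fE gE /bdiff comp_polyM; ring.
rewrite todd_bdiff // derivM hornerD !hornerM !horner0_antidiff.
by rewrite mul0r mulr0 addr0.
Qed.

(** In the product rule, the Todd term of [deriv_antidiff] is the cut at the root, and the other
    terms are the cuts inside the children. The tree cut off counts as standalone; at a right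
    pointing root, [todd_spine_poly] supplies this change of direction. *)
Lemma deriv_spine_poly b V : (spine_poly b V)^`() =
  \sum_(c <- cuts b V)
    (todd (spine_poly true c.1.2) * (if c.1.1 then 1 else -1)) *: spine_poly b c.2.
Proof.
elim: V b => [[]|l IHl r IHr] b; first by rewrite /= big_nil -polyC1 derivC.
rewrite /= big_cons big_cat !big_map /=; case: b => /=.
  rewrite derivM deriv_antidiff deriv_shift -todd_spine_poly IHr mulrDl.
  rewrite [X in X + _ = _]addrC -addrA; congr (_ + (_ + _)).
  - by rewrite mul_polyC mulr1.
  - rewrite IHl linear_sum /= linear_sum mulr_suml; apply: eq_bigr => c _.
    by rewrite comp_polyZ linearZ /= scalerAl.
  - by rewrite mulr_sumr; apply: eq_bigr => c _; rewrite scalerAr.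
rewrite derivM derivN deriv_antidiff opprD mulrDl -addrA addrCA; congr (_ + _).
  by rewrite mulrN1 scaleNr -mul_polyC mulNr.
rewrite addrC; congr (_ + _).
  by rewrite IHl mulr_sumr; apply: eq_bigr => c _; rewrite scalerAr.
rewrite IHr linear_sum /= -sumrN mulr_suml; apply: eq_bigr => c _.
by rewrite linearZ /= -scalerN scalerAl.
Qed.

Lemma horner0_spine_poly T b : (spine_poly b T).[0] = (T == leaf)%:R.
Proof.
case: T => [[]|l r] /=; first by rewrite hornerC.
by case: b; rewrite ?mulNr ?hornerN hornerM horner0_antidiff mul0r ?oppr0.
Qed.

Lemma spine_poly_solution : is_solution (spine_poly true).
Proof.
split=> T; last exact: horner0_spine_poly.
rewrite deriv_spine_poly prelie_cuts; apply: eq_bigr => c _.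
rewrite -mul_polyC polyCM -!mulrA; congr (_ * _); rewrite mulrC.
by case: c.1.1; rewrite // polyCN.
Qed.

End SpinePolynomials.

(* Removal of leaves from labeled trees *)
Local Close Scope ring_scope.

Implicit Types (L : bintree nat) (w : seq nat).

Lemma leaves_neq0 (A : eqType) (T : bintree A) : leaves T != [::].
Proof. by rewrite -size_eq0 -lt0n nleaves_gt0. Qed.

Lemma head_leaves_node L1 L2 : head 0 (leaves (Node L1 L2)) = head 0 (leaves L1).
Proof. by rewrite /=; case: (leaves L1) (leaves_neq0 L1). Qed.

Lemma last_leaves_node L1 L2 : last 0 (leaves (Node L1 L2)) = last 0 (leaves L2).
Proof. by rewrite /= last_cat; case: (leaves L2) (leaves_neq0 L2). Qed.

Lemma head_leaves_in L : head 0 (leaves L) \in leaves L.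
Proof. by case: (leaves L) (leaves_neq0 L) => //= a s _; rewrite mem_head. Qed.

Lemma last_leaves_in L : last 0 (leaves L) \in leaves L.
Proof. by case: (leaves L) (leaves_neq0 L) => //= a s _; rewrite mem_last. Qed.

Lemma removable_in s a L : removable_from s a L -> a \in leaves L.
Proof.
elim: L s => //= l IHl r IHr s; rewrite mem_cat.
by case/or3P => [|/IHl -> //|/IHr ->]; [case: s => /eqP -> /=; rewrite mem_head ?orbT|rewrite orbT].
Qed.

Lemma remove_leaf_notin a L : a \notin leaves L -> remove_leaf L a = L.
Proof.
elim: L => //= l IHl r IHr; rewrite mem_cat negb_or => /andP[al ar].
rewrite IHl // IHr // !ifN //.
  by apply: contraNneq ar => ->; rewrite mem_head.
by apply: contraNneq al => ->; rewrite mem_head.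
Qed.

Lemma notin_removableF s a L : a \notin leaves L -> removable_from s a L = false.
Proof. by move=> aL; apply: contraNF aL => /removable_in. Qed.

Lemma uniq_leaves_node L1 L2 : uniq (leaves (Node L1 L2)) ->
  [/\ uniq (leaves L1), uniq (leaves L2),
      {in leaves L1, forall a, a \notin leaves L2} &
      {in leaves L2, forall a, a \notin leaves L1}].
Proof.
rewrite /= cat_uniq => /and3P[u1 /hasPn h u2]; split=> // a a1.
by apply/negP => /h /negP.
Qed.

Lemma leaves_remove a L : uniq (leaves L) -> L != Leaf a ->
  leaves (remove_leaf L a) = [seq b <- leaves L | b != a].
Proof.
elim: L => [b|l IHl r IHr] /=; first by move=> _ /eqP e; case: eqP => // ba; case: e; rewrite ba.
move=> /uniq_leaves_node[ul ur lr rl] _; rewrite filter_cat.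
have [lE|nl] := eqVneq l (Leaf a).
  rewrite lE /= eqxx /=; apply/esym/all_filterP/allP => b br.
  by apply: contraTneq br => ->; apply: lr; rewrite lE mem_head.
have [rE|nr] := eqVneq r (Leaf a).
  rewrite rE /= eqxx cats0; apply/esym/all_filterP/allP => b bl.
  by apply: contraTneq bl => ->; apply: rl; rewrite rE mem_head.
by rewrite /= IHl // IHr.
Qed.

(** The leaf reached by always continuing in the given direction. For a removable child, it is the
    leaf that disappears together with the parent. *)
Definition spine_end (right : bool) L :=
  if right then last 0 (leaves L) else head 0 (leaves L).

Arguments spine_end : simpl never.

(** Along the spine all directions are [s], while a removable leaf points opposite to its parent. *)
Lemma spine_end_not_removable s a L : uniq (leaves L) ->
  removable_from s a L -> a != spine_end s L.
Proof.
elim: L s => // l IHl r IHr s /uniq_leaves_node[ul ur lr rl].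
rewrite /spine_end head_leaves_node last_leaves_node => /or3P[|h|h].
- case: s => /eqP e; apply: contraTneq (mem_head a [::]) => h.
    by have := lr a; rewrite e mem_head h last_leaves_in => /(_ isT).
  by have := rl a; rewrite e mem_head h head_leaves_in => /(_ isT).
- case: s; last exact: (IHl false).
  by apply: contraTneq (lr _ (removable_in h)) => ->; rewrite negbK last_leaves_in.
- case: s; first exact: (IHr true).
  by apply: contraTneq (rl _ (removable_in h)) => ->; rewrite negbK head_leaves_in.
Qed.

Lemma head_filter (T : eqType) x0 (p : pred T) (s : seq T) :
  p (head x0 s) -> head x0 [seq x <- s | p x] = head x0 s.
Proof. by case: s => //= x s ->. Qed.

Lemma last_filter (T : eqType) x0 (p : pred T) (s : seq T) :
  p (last x0 s) -> last x0 [seq x <- s | p x] = last x0 s.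
Proof.
by case/lastP: s => //= s x; rewrite last_rcons filter_rcons => ->; rewrite last_rcons.
Qed.

Lemma removable_neq_leaf s a b L : removable_from s a L -> L != Leaf b.
Proof. by case: L. Qed.

Lemma spine_end_remove s a L : uniq (leaves L) ->
  removable_from s a L -> spine_end s (remove_leaf L a) = spine_end s L.
Proof.
move=> uL aL; have := spine_end_not_removable uL aL.
rewrite /spine_end leaves_remove ?(removable_neq_leaf _ aL) //.
by case: s {aL}; rewrite eq_sym => ae; rewrite ?head_filter ?last_filter.
Qed.

Lemma uniq_remove a L : uniq (leaves L) -> L != Leaf a -> uniq (leaves (remove_leaf L a)).
Proof. by move=> uL nL; rewrite leaves_remove // filter_uniq. Qed.

Lemma nleaves_remove s a L : uniq (leaves L) -> removable_from s a L ->
  nleaves (remove_leaf L a) = (nleaves L).-1.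
Proof.
move=> uL aL; rewrite /nleaves leaves_remove ?(removable_neq_leaf _ aL) //.
by rewrite -rem_filter // size_rem // (removable_in aL).
Qed.

(** * Forest maps and their decomposition along removal orders *)

(* Counts the maps from the inner vertices of L to the interval [lo, hi) which
   increase from children to parents in the forest of inner vertices, the value
   at a vertex being congruent modulo M to the label of the leaf removed with
   it.  Writing values as x * M + label, this is a count of maps x in which
   ties are broken by labels. *)
Section ForestMaps.
Variable M : nat.

Fixpoint forest_maps (right : bool) L (lo hi : nat) : nat :=
  match L with
  | Leaf _ => 1
  | Node l r =>
      if right then
        (\sum_(lo <= p < hi | p %% M == spine_end false l) forest_maps false l lo p) *
        forest_maps true r lo hi
      else
        (\sum_(lo <= p < hi | p %% M == spine_end true r) forest_maps true r lo p) *
        forest_maps false l lo hi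
  end.

Lemma forest_maps_empty s L lo : forest_maps s L lo lo = (if L is Leaf _ then 1 else 0).
Proof. by case: L => //= l r; case: s; rewrite big_geq ?mul0n. Qed.

(** The term [p = lo] leaves the subtree an empty interval, so it contributes only for a leaf. The
    hypothesis is [forest_maps_step] for the subtree, to be supplied by the induction there. *)
Let sum_forest_maps_step s e L lo hi :
  (forall hi, lo < hi -> forest_maps s L lo hi = forest_maps s L lo.+1 hi +
     removable_from s (lo %% M) L * forest_maps s (remove_leaf L (lo %% M)) lo.+1 hi) ->
  lo < hi ->
  \sum_(lo <= p < hi | p %% M == e) forest_maps s L lo p =
  (lo %% M == e) * (if L is Leaf _ then 1 else 0) +
  (\sum_(lo.+1 <= p < hi | p %% M == e) forest_maps s L lo.+1 p +
  removable_from s (lo %% M) L *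
    \sum_(lo.+1 <= p < hi | p %% M == e)
      forest_maps s (remove_leaf L (lo %% M)) lo.+1 p).
Proof.
move=> IH lohi; rewrite big_ltn_cond // -(forest_maps_empty s L lo).
set S := (S in if _ then _ + S else S).
transitivity ((lo %% M == e) * forest_maps s L lo lo + S).
  by case: ifP; rewrite ?mul1n.
congr (_ + _); rewrite big_distrr -big_split /=.
by apply: congr_big_nat => // p /andP[_ /andP[lop _]]; apply: IH.
Qed.

(** Labels are distinct, so at most one vertex takes the value [lo]. Being least, it has no
    descendants in the forest, so its leaf is removable, and the other vertices form the forest of
    the tree without that leaf. *)
Lemma forest_maps_step s L lo hi : uniq (leaves L) -> lo < hi ->
  forest_maps s L lo hi = forest_maps s L lo.+1 hi +
    removable_from s (lo %% M) L * forest_maps s (remove_leaf L (lo %% M)) lo.+1 hi.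
Proof.
elim: L s hi => [b|l IHl r IHr] s hi; first by rewrite /= mul0n addn0.
move=> /uniq_leaves_node[ul ur lr rl] lohi.
set a := lo %% M.
have fl b : l = Leaf b -> b \notin leaves r by move=> lE; apply: lr; rewrite lE mem_head.
have fr b : r = Leaf b -> b \notin leaves l by move=> rE; apply: rl; rewrite rE mem_head.
(* [remove_leaf] tests the left child first. *)
have nl : r = Leaf a -> (l == Leaf a) = false.
  by move=> /fr h; apply: contraNF h => /eqP ->; rewrite mem_head.
case: s => /=.
- rewrite sum_forest_maps_step //; last by move=> *; apply: IHl.
  rewrite (IHr true) // -/a.
  (* The vertex with value [lo] is the root, or lies in [l], or lies in [r]; distinct labels make
     the cases exclusive. *)
  have [lE|ll] := eqVneq l (Leaf a).
    rewrite lE /spine_end /= eqxx /= (notin_removableF true (fl _ lE)); lia.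
  have -> : (a == spine_end false l) * (if l is Leaf _ then 1 else 0) = 0.
    case: l ll {IHl ul lr rl fl fr nl} => [b|]; last by move=> *; rewrite muln0.
    by rewrite /spine_end /=; case: (a =P b) => [<-|]; rewrite ?eqxx.
  case: (boolP (removable_from false a l)) => [al|nal] /=.
    have ar := lr _ (removable_in al).
    rewrite notin_removableF // (remove_leaf_notin ar) ifN; last first.
      by apply: contraNneq ar => ->; rewrite mem_head.
    rewrite /= (spine_end_remove ul al); lia.
  case: (boolP (removable_from true a r)) => [ar|nar] /=; last lia.
  rewrite (remove_leaf_notin (rl _ (removable_in ar))) ifN ?(removable_neq_leaf _ ar) //=.
  lia.
- rewrite sum_forest_maps_step //; last by move=> *; apply: IHr.
  rewrite (IHl false) // -/a.
  have [rE|rr] := eqVneq r (Leaf a).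
    rewrite nl // rE /spine_end /= eqxx /= (notin_removableF false (fr _ rE)); lia.
  have -> : (a == spine_end true r) * (if r is Leaf _ then 1 else 0) = 0.
    case: r rr {IHr ur lr rl fl fr nl} => [b|]; last by move=> *; rewrite muln0.
    by rewrite /spine_end /=; case: (a =P b) => [<-|]; rewrite ?eqxx.
  case: (boolP (removable_from true a r)) => [ar|nar] /=.
    have al := rl _ (removable_in ar).
    rewrite notin_removableF // (remove_leaf_notin al) ifN; last first.
      by apply: contraNneq al => ->; rewrite mem_head.
    rewrite /= (spine_end_remove ur ar); lia.
  rewrite orbF.
  case: (boolP (removable_from false a l)) => [al|nal] /=; last lia.
  rewrite (remove_leaf_notin (lr _ (removable_in al))) ifN ?(removable_neq_leaf _ al) //=.
  lia.
Qed.

Fixpoint chains (hi lo : nat) w : nat :=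
  if w is b :: w' then \sum_(lo <= p < hi | p %% M == b) chains hi p.+1 w' else 1.

Fixpoint removal_words (m : nat) L : seq (seq nat) :=
  if m is m'.+1 then
    flatten [seq [seq a :: w | w <- removal_words m' (remove_leaf L a)]
            | a <- leaves L & removable a L]
  else [:: [::]].

(** Listing the vertices by increasing value turns a forest map into a removal order with a chain of
    values. The proof raises [lo] by one and matches [forest_maps_step] with the recursion of
    [chains]. *)
Lemma forest_maps_removal_words L lo hi : uniq (leaves L) -> lo <= hi ->
  forest_maps true L lo hi =
  \sum_(w <- removal_words (nleaves L).-1 L) chains hi lo w.
Proof.
move=> uL /subnKC <-; move: (hi - lo) => n {hi}.
elim: n lo L uL => [|n IH] lo [b|l r] uL; rewrite ?big_seq1 //.
  rewrite addn0 forest_maps_empty big1_seq // => w /andP[_].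
  have : 0 < (nleaves (Node l r)).-1.
    by rewrite nleaves_node; have := nleaves_gt0 l; have := nleaves_gt0 r; lia.
  case: (nleaves _).-1 => // m _ /flatten_mapP[a _ /mapP[w' _ ->]].
  by rewrite /= big_geq.
rewrite forest_maps_step ?addnS ?ltnS ?leq_addr // -addSn IH //.
have : 0 < (nleaves (Node l r)).-1.
  by rewrite nleaves_node; have := nleaves_gt0 l; have := nleaves_gt0 r; lia.
have nE s a := @nleaves_remove s a _ uL.
move: uL nE; move: (Node l r) => L uL nE.
case mE : (nleaves L).-1 => [//|m] _.
rewrite /= !big_flatten !big_map !big_filter /=.
set a0 := lo %% M; set hi := lo.+1 + n.
(* The chains starting at the value [lo] are split off; their first letter has to be [a0]. *)
transitivity (\sum_(a <- leaves L | removable a L)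
   \sum_(w <- removal_words m (remove_leaf L a))
     (\sum_(lo.+1 <= p < hi | p %% M == a) chains hi p.+1 w + (a0 == a) * chains hi lo.+1 w));
  last first.
  apply: eq_bigr => a _; rewrite big_map; apply: eq_bigr => w _.
  rewrite /= [RHS]big_ltn_cond ?/hi ?addSn ?ltnS ?leq_addr //.
  by rewrite -/a0; case: eqP => _; rewrite ?mul1n ?mul0n ?addn0 // addnC.
under [RHS]eq_bigr do rewrite big_split /=.
rewrite big_split /=; congr (_ + _); first by apply: eq_bigr => a _; rewrite big_map.
case: (boolP (removable a0 L)) => [aL|naL]; last first.
  rewrite /removable in naL; rewrite (negPf naL) mul0n big1 // => a aL.
  rewrite big1 // => w _; case: eqP => // e.
  by case/negP: naL; rewrite e.
rewrite /removable in aL; rewrite aL mul1n IH; last exact: uniq_remove uL (removable_neq_leaf a0 aL).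
rewrite (nE true) // mE /=.
rewrite [RHS]big_mkcond (bigD1_seq a0) ?(removable_in aL) //= ifT //.
rewrite [X in _ = _ + X]big1 ?addn0 => [|a ne]; last first.
  by case: ifP => // _; rewrite big1 // => w _; rewrite eq_sym (negPf ne).
by apply: eq_bigr => w _; rewrite eqxx mul1n.
Qed.

End ForestMaps.

(** * Counting chains by binomial coefficients *)

Lemma ltn_lex M x y a b : a < M -> b < M ->
  (x * M + a < y * M + b) = (x < y + (a < b)).
Proof.
move=> aM bM; case: (ltngtP x y) => [xy|yx|->].
- have := leq_mul xy (leqnn M); rewrite mulSn => h.
  rewrite (ltn_addr _ xy); apply: leq_trans (leq_addr b _); apply: leq_trans h.
  by rewrite addnC ltn_add2r.
- have := leq_mul yx (leqnn M); rewrite mulSn => h.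
  have yx' : y + (a < b) <= x by rewrite (leq_trans _ yx) // -[y.+1]addn1 leq_add2l leq_b1.
  rewrite ltnNge [RHS]ltnNge yx'.
  rewrite (leq_trans _ (leq_addr a _)) // (leq_trans _ h) //.
  by rewrite addnC leq_add2r ltnW.
- by rewrite ltn_add2l -[X in _ = (X < _)]addn0 ltn_add2l lt0b.
Qed.

(** Extended by zero and cut into blocks of length [M], the sum has at most one term of the class in
    each block. *)
Lemma sum_residue_class M b lo hi x0 x1 (F : nat -> nat) : b < M ->
    (forall x, (lo <= x * M + b < hi) = (x0 <= x < x1)) ->
  \sum_(lo <= p < hi | p %% M == b) F p = \sum_(x0 <= x < x1) F (x * M + b).
Proof.
move=> bM xE; have M_gt0 : 0 < M by apply: leq_trans bM.
pose N := maxn hi x1.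
have hN : hi <= N * M by rewrite -[hi]muln1 leq_mul ?leq_maxl.
transitivity (\sum_(0 <= p < N * M) if (lo <= p < hi) && (p %% M == b) then F p else 0).
  rewrite [LHS](big_nat_widen _ _ (N * M)) // [LHS](big_nat_widenl _ 0) //.
  rewrite big_mkcond; apply: eq_bigr => p _.
  by case: (p %% M == b); case: (lo <= p); case: (p < hi).
rewrite big_nat_mul.
transitivity (\sum_(0 <= x < N) if x0 <= x < x1 then F (x * M + b) else 0); last first.
  rewrite [RHS](big_nat_widen _ _ N) ?leq_maxr // [RHS](big_nat_widenl _ 0) //.
  by rewrite [RHS]big_mkcond; apply: eq_bigr => p _; rewrite andbC.
apply: eq_bigr => x _; rewrite (bigD1_seq (x * M + b)) ?iota_uniq //=; last first.
  by rewrite mem_index_iota leq_addr mulSn addnC ltn_add2r.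
rewrite xE modnMDl modn_small // eqxx andbT big1_seq ?addn0 // => p /andP[pne].
rewrite mem_index_iota => /andP[xp px]; case: ifP => // /andP[_ /eqP pb].
case/eqP: pne; rewrite -pb (divn_eq p M) modnMDl modn_mod; congr (_ * _ + _).
by apply/eqP; rewrite eqn_leq -ltnS ltn_divLR // px leq_divRL.
Qed.

(** Weak descents of [w] preceded by [a]: the steps at which the quotient of a chain modulo [M] is
    forced to grow. *)
Fixpoint word_descents (a : nat) w : nat :=
  if w is b :: w' then (b <= a) + word_descents b w' else 0.

Lemma word_descents_le a w : word_descents a w <= size w.
Proof. by elim: w a => //= b w IH a; rewrite -add1n leq_add ?leq_b1. Qed.

(** Pascal's rule, by downward induction on [x]. The bound [d <= m] keeps the truncated subtractions
    exact. *)
Lemma hockey_stick m k d x : d <= m -> x <= k.+1 ->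
  \sum_(x <= y < k.+1) 'C(m + k - (y + d), m) = 'C(m.+1 + k - (x + d), m.+1).
Proof.
move=> dm xk; rewrite -(subKn xk); move: (_ - x) (leq_subr x k.+1) => n {x xk}.
elim: n => [|n IH] nk.
  by rewrite subn0 big_geq // bin_small //; lia.
rewrite big_ltn; last lia.
have -> : (k.+1 - n.+1).+1 = k.+1 - n by lia.
rewrite IH; last lia.
have -> : m.+1 + k - (k.+1 - n.+1 + d) = (m + k - (k.+1 - n.+1 + d)).+1 by lia.
have -> : m.+1 + k - (k.+1 - n + d) = m + k - (k.+1 - n.+1 + d) by lia.
by rewrite binS addnC.
Qed.

(** After [x * M + a], a value [y * M + b] is allowed if [y] is at least [x], or [x + 1] at a weak
    descent; [hockey_stick] sums over [y]. *)
Lemma chains_binomial M k w x a :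
  a < M -> all (fun b => b < M) w -> x <= k ->
  chains M (k.+1 * M) (x * M + a).+1 w =
    'C(size w + k - (x + word_descents a w), size w).
Proof.
elim: w x a => [|b w IH] x a aM /=; first by rewrite bin0.
case/andP=> bM wM xk.
rewrite (@sum_residue_class M b _ _ (x + (b <= a)) k.+1) //; last first.
  move=> y; rewrite ltn_lex // -[k.+1 * M]addn0 ltn_lex ?(leq_trans _ bM) // addn0.
  by congr (_ && _); case: (ltnP a b); rewrite ?addn0 ?addn1.
rewrite addnA -hockey_stick ?word_descents_le //; last by case: leqP; lia.
by apply: congr_big_nat => // y /andP[_ /andP[_ yk]]; apply: IH.
Qed.

(** * Forest counts as values of the spine polynomials *)

Section ForestMapsPolynomial.
Local Open Scope ring_scope.
Variables (K : fieldType) (charK : [pchar K] =i pred0) (M : nat).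

(** The last hypothesis says that [hi] bounds quotients by [X] for every label but that of the spine
    end, which belongs to no vertex of [L]. *)
Lemma forest_maps_spine_poly s L X hi :
    uniq (leaves L) -> extremal_ends L -> all (fun a => 0 < a < M)%N (leaves L) ->
    (forall b, b \in leaves L -> b != spine_end s L ->
       forall x, (x * M + b < hi)%N = (x < X)%N) ->
  (forest_maps M s L 1 hi)%:R =
  (-1) ^+ (right_leaves_from s (Defs.shape L) + s) *
    (spine_poly charK s (Defs.shape L)).[X%:R] :> K.
Proof.
elim: L s X hi => [b|l IHl r IHr] s X hi.
  by move=> _ _ _ _ /=; rewrite hornerC mulr1 -signr_odd; case: s.
move=> uL /= /and3P[/allP ext extl extr] labels hX.
have [ul ur lr rl] := uniq_leaves_node uL.
have [labl labr] : all (fun a => 0 < a < M)%N (leaves l) /\ all (fun a => 0 < a < M)%N (leaves r).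
  by move: labels; rewrite all_cat => /andP.
have hl : head 0%N (leaves l ++ leaves r) = head 0%N (leaves l) by exact: head_leaves_node.
have hr : last 0%N (leaves l ++ leaves r) = last 0%N (leaves r) by exact: last_leaves_node.
rewrite hl hr in ext.
have b_l := head_leaves_in l; have c_r := last_leaves_in r.
have /andP[b0 bM] := allP labl _ b_l; have /andP[c0 cM] := allP labr _ c_r.
have bc : head 0%N (leaves l) != last 0%N (leaves r).
  by apply: contraTneq b_l => ->; apply: rl.
case: s hX; rewrite /spine_end ?hl ?hr => hX.
(* Labels are positive, so the lower bound 1 excludes no value. *)
- rewrite (@sum_residue_class M _ _ _ 0 X) //; last first.
    by move=> x; rewrite hX ?mem_cat ?b_l // addn_gt0 b0 orbT.
  rewrite natrM (IHr true X) //; last first.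
    by move=> b br bne x; apply: hX => //; rewrite mem_cat br orbT.
  rewrite natr_sum big_mkord.
  rewrite (eq_bigr (fun x : 'I_X => (-1) ^+ (right_leaves_from false (Defs.shape l)) *
       (spine_poly charK false (Defs.shape l)).[(x : nat)%:R])); last first.
    (* The label of the root vertex is minimal, so a tie of quotients is forbidden and the bound is
       [x]. *)
    move=> x _; rewrite (IHl false x) ?addn0 // => a al ane y.
    have /andP[a0 aM] := allP labl _ al.
    have ain : a \in leaves l ++ leaves r by rewrite mem_cat al.
    have /andP[] := ext a ain.
    rewrite leq_eqVlt eq_sym (negPf ane) /= => ba _.
    by rewrite ltn_lex // (ltnNge a) (ltnW ba) addn0.
  rewrite -mulr_sumr hornerM horner_antidiff_nat.
  under [in RHS]eq_bigr do rewrite horner_comp !hornerE -natr1 addrK.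
  by rewrite !exprD; ring.
- rewrite (@sum_residue_class M _ _ _ 0 X) //; last first.
    by move=> x; rewrite hX ?mem_cat ?c_r ?orbT 1?eq_sym // addn_gt0 c0 orbT.
  rewrite natrM (IHl false X) //; last first.
    by move=> b bl bne x; apply: hX => //; rewrite mem_cat bl.
  rewrite natr_sum big_mkord.
  rewrite (eq_bigr (fun x : 'I_X => (-1) ^+ (right_leaves_from true (Defs.shape r) + 1) *
       (spine_poly charK true (Defs.shape r)).[x.+1%:R])); last first.
    (* Here it is maximal, so ties are allowed and the bound is [x.+1]. *)
    move=> x _; rewrite (IHr true x.+1) // => a ar ane y.
    have /andP[a0 aM] := allP labr _ ar.
    have ain : a \in leaves l ++ leaves r by rewrite mem_cat ar orbT.
    have /andP[_] := ext a ain.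
    rewrite leq_eqVlt (negPf ane) /= => ac.
    by rewrite ltn_lex // ac addn1.
  rewrite -mulr_sumr hornerM hornerN horner_antidiff_nat.
  by rewrite !exprD expr1 expr0; ring.
Qed.

End ForestMapsPolynomial.

(** * Removal words, permutations and descents *)

Fixpoint is_removal_word L w : bool :=
  if w is a :: w' then removable a L && is_removal_word (remove_leaf L a) w'
  else true.

Lemma mem_removal_words m L w :
  (w \in removal_words m L) = (size w == m) && is_removal_word L w.
Proof.
elim: m L w => [|m IH] L [|a w] //=.
  by apply/negbTE/flatten_mapP => -[b _ /mapP[]].
apply/flatten_mapP/idP => [[b]|].
  rewrite mem_filter => /andP[bL _] /mapP[w' w'P [-> ->]].
  by rewrite bL /= eqSS -IH.
rewrite eqSS => /and3P[sw aL wP]; exists a.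
  by rewrite mem_filter aL (removable_in aL).
by apply/mapP; exists w; rewrite // IH sw.
Qed.

Lemma removal_words_uniq m L : uniq (leaves L) -> uniq (removal_words m L).
Proof.
elim: m L => //= m IH L uL.
apply: (@allpairs_uniq_dep _ _ _ _ _ (fun a => removal_words m (remove_leaf L a))).
- exact: filter_uniq.
- move=> a; rewrite mem_filter => /andP[aL _]; apply: IH.
  exact: uniq_remove uL (removable_neq_leaf a aL).
- by move=> [a w] [b w'] _ _ /= [-> ->].
Qed.

Lemma is_removal_wordP L w :
  reflect (forall i, i < size w ->
             removable (nth 0 w i) (foldl remove_leaf L (take i w)))
          (is_removal_word L w).
Proof.
elim: w L => [|a w IH] L /=; first by constructor.
apply: (iffP andP) => [[aL /IH wP] [|i] //=|wP]; first exact: wP.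
by split; [apply: (wP 0)|apply/IH => i; apply: (wP i.+1)].
Qed.

Lemma removal_word_labels L w : uniq (leaves L) -> is_removal_word L w ->
  [/\ uniq w, {subset w <= leaves L} & spine_end true L \notin w].
Proof.
elim: w L => [|a w IH] L uL //= /andP[aL wL].
have nL := removable_neq_leaf a aL.
have [uw sub endw] := IH _ (uniq_remove uL nL) wL.
have sub' b : b \in w -> b \in leaves L /\ b != a.
  by move/sub; rewrite leaves_remove // mem_filter => /andP[].
split.
- by rewrite uw andbT; apply/negP => /sub'[_ /eqP].
- by move=> b; rewrite inE => /orP[/eqP ->|/sub'[]] //; apply: removable_in aL.
- rewrite inE negb_or eq_sym (spine_end_not_removable uL aL) /=.
  by rewrite -(spine_end_remove uL aL).
Qed.

Section PermWord.
Variable n : nat.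
Implicit Type s : {perm 'I_n}.

Lemma size_perm_word s : size (perm_word s) = n.
Proof. by rewrite size_map size_enum_ord. Qed.

Lemma nth_perm_word s (i : 'I_n) : nth 0 (perm_word s) i = (s i).+1.
Proof. by rewrite (nth_map i) ?size_enum_ord // nth_ord_enum. Qed.

Lemma perm_word_inj : injective (@perm_word n).
Proof.
move=> s t e; apply/permP => i; apply/val_inj/succn_inj.
by rewrite -!nth_perm_word e.
Qed.

Lemma perm_word_onto w : size w = n -> uniq w ->
  {in w, forall a, 0 < a <= n} -> exists s, perm_word s = w.
Proof.
move=> sw uw wn.
have wP (i : 'I_n) : 0 < nth 0 w i <= n by apply: wn; rewrite mem_nth ?sw.
(* The default [i] is never taken, since all letters lie between 1 and [n]. *)
pose f (i : 'I_n) := insubd i (nth 0 w i).-1.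
have fE i : (f i).+1 = nth 0 w i.
  have /andP[w0 wi] := wP i.
  by rewrite val_insubd -ltnS (prednK w0) ltnS wi prednK.
have f_inj : injective f.
  move=> i j e; apply/val_inj/eqP; rewrite -(nth_uniq 0 _ _ uw) ?sw //=.
  by rewrite -!fE e.
exists (perm f_inj); apply: (@eq_from_nth _ 0); rewrite size_perm_word ?sw //.
by move=> i ni; rewrite (nth_perm_word _ (Ordinal ni)) permE fE.
Qed.

End PermWord.

Lemma word_descentsE a w :
  word_descents a w = \sum_(0 <= i < size w) (nth 0 w i <= nth 0 (a :: w) i).
Proof.
elim: w a => [|b w IH] a /=; first by rewrite big_geq.
by rewrite big_nat_recl //= IH.
Qed.

(** The first letter is no descent after 0, and weak descents are strict because letters are
    distinct. *)
Lemma descents_perm_word n (s : {perm 'I_n}) :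
  descents s = word_descents 0 (perm_word s).
Proof.
case: n s => [|n] s.
  rewrite word_descentsE size_perm_word big_geq //.
  by apply: eq_card0 => i; have := ltn_ord i; rewrite ltn0.
rewrite word_descentsE size_perm_word big_nat_recl //=.
rewrite (nth_perm_word s ord0) ltn0 add0n.
rewrite /descents -sum1_card big_mkcond big_ord_recr /= inE.
case: existsP => [[j /andP[/eqP jn _]]|_].
  by have := ltn_ord j; rewrite jn ltnn.
rewrite addn0 big_mkord; apply: eq_bigr => i _; rewrite inE.
have i1 : i.+1 < n.+1 by rewrite ltnS.
rewrite (nth_perm_word s (Ordinal i1)) (nth_perm_word s (widen_ord (leqnSn n) i)) ltnS.
rewrite leq_eqVlt (inj_eq val_inj) (inj_eq perm_inj) -val_eqE /= eqn_leq ltnn /=.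
case: existsP => [[j /andP[/eqP ji]]|h].
  by have -> : j = Ordinal i1 by [apply: val_inj]; move=> ->.
by case: ltnP => // lt; case: h; exists (Ordinal i1); rewrite eqxx.
Qed.

Lemma word_descents0_lt w : 0 < size w -> {in w, forall a, 0 < a} ->
  word_descents 0 w < size w.
Proof.
case: w => //= a w _ w0; rewrite [a <= 0]leqNgt (w0 a) ?mem_head //=.
by rewrite ltnS word_descents_le.
Qed.

Lemma nleaves_shape (A : Type) (T : bintree A) : nleaves (Defs.shape T) = nleaves T.
Proof. by elim: T => //= l IHl r IHr; rewrite !nleaves_node IHl IHr. Qed.

(** The distinct labels fill the whole range, so the largest one occurs, and the rightmost leaf has
    to carry it. *)
Lemma admissible_last T L : admissible T L -> last 0 (leaves L) = nleaves T.
Proof.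
case/and4P => /eqP sh uL /allP lab ext.
have sz : size (leaves L) = nleaves T by rewrite -sh nleaves_shape.
have [_ /(_ (nleaves T))] : (size (leaves L) = size (iota 1 (nleaves T))) *
    (leaves L =i iota 1 (nleaves T)).
  apply: uniq_min_size; rewrite ?size_iota ?sz //.
  by move=> a /lab; rewrite mem_iota add1n ltnS.
rewrite mem_iota add1n ltnSn nleaves_gt0 /= => nL.
have /andP[_ lastn] := lab _ (last_leaves_in L).
apply/eqP; rewrite eqn_leq lastn.
case: L ext nL {sh uL lab sz lastn} => [a _|l r /= /and3P[/allP ext _ _] /ext /andP[_] //].
by rewrite inE => /eqP -> /=.
Qed.

(** Removal words never contain the rightmost leaf, hence avoid the largest label and come from
    permutations of the others. *)
Lemma sum_removal_perms T L (F : seq nat -> nat) : admissible T L ->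
  \sum_(s in removal_perms L) F (perm_word s) =
  \sum_(w <- removal_words (nleaves L).-1 L) F w.
Proof.
move=> admL; have lastL := admissible_last admL.
case/and4P: admL => /eqP sh uL /allP lab _.
have nT : nleaves T = nleaves L by rewrite -sh nleaves_shape.
rewrite -big_enum -(big_map _ predT F) /=; apply: perm_big.
apply: uniq_perm.
- by rewrite map_inj_uniq ?enum_uniq //; apply: perm_word_inj.
- exact: removal_words_uniq.
have permP (s : {perm 'I_(nleaves L).-1}) :
    (s \in removal_perms L) = is_removal_word L (perm_word s).
  rewrite inE; apply/forallP/is_removal_wordP => sP i.
    by rewrite size_perm_word => ni; rewrite (nth_perm_word s (Ordinal ni)); apply: sP.
  by rewrite -nth_perm_word; apply: sP; rewrite size_perm_word.
move=> w; rewrite mem_removal_words; apply/mapP/andP => [[s]|[/eqP sw wP]].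
  by rewrite mem_enum permP => sP ->; rewrite size_perm_word.
have [uw sub] := removal_word_labels uL wP.
rewrite /spine_end lastL => endw.
have [|s sE] := perm_word_onto sw uw; last first.
  by exists s => //; rewrite mem_enum permP sE.
move=> a aw; have /andP[a0 an] := lab a (sub a aw); rewrite a0 /=.
rewrite -ltnS prednK ?nleaves_gt0 // ltn_neqAle -nT an andbT.
by apply: contraNneq endw => <-.
Qed.

Lemma sum_eulerian_count T L (F : nat -> nat) : admissible T L -> 1 < nleaves T ->
  \sum_(d < (nleaves T).-1) F d * eulerian_count L d =
  \sum_(w <- removal_words (nleaves L).-1 L) F (word_descents 0 w).
Proof.
move=> admL T_ge2.
rewrite -(sum_removal_perms (fun w => F (word_descents 0 w)) admL).
have nT : nleaves T = nleaves L by case/and4P: admL => /eqP <- *; rewrite nleaves_shape.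
transitivity (\sum_(d < (nleaves T).-1) \sum_(s in removal_perms L)
    if descents s == d then F d else 0).
  apply: eq_bigr => d _; rewrite /eulerian_count -sum1_card big_distrr /=.
  under eq_bigl do rewrite inE.
  by rewrite big_mkcondr; apply: eq_bigr => s _; case: ifP; rewrite ?muln1 ?muln0.
rewrite exchange_big; apply: eq_bigr => s _; rewrite descents_perm_word.
have lt : word_descents 0 (perm_word s) < (nleaves T).-1.
  rewrite nT -[X in _ < X](size_perm_word s); apply: word_descents0_lt.
    by rewrite size_perm_word -nT; lia.
  by move=> a /mapP[i _ ->].
by rewrite -big_mkcond (big_pred1 (Ordinal lt)) // => d; rewrite eq_sym.
Qed.

Lemma right_leaves_gt0 T : 0 < right_leaves T.
Proof. by elim: T => //= l _ r IHr; rewrite /right_leaves /= addn_gt0 IHr orbT. Qed.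

Local Open Scope ring_scope.

Theorem theorem4p11 (K : fieldType) (charK : [pchar K] =i pred0)
    (P : pbtree -> {poly K}) (solP : is_solution P)
    (T : pbtree) (T_ge2 : (2 <= nleaves T)%N)
    (L : bintree nat) (admL : admissible T L) (k : nat) :
  (-1) ^+ (right_leaves T).-1 * (P T).[k.+1%:R] =
    \sum_(d < (nleaves T).-1)
      ('C((nleaves T).-1 + k - d, (nleaves T).-1))%:R *
      (eulerian_count L d)%:R.
Proof.
rewrite (is_solution_unique charK solP (spine_poly_solution charK)).
under eq_bigr do rewrite -natrM.
rewrite -natr_sum (sum_eulerian_count (fun d => 'C((nleaves T).-1 + k - d, _))) //.
have /and4P[/eqP shL uL /allP lab ext] := admL.
have nT : nleaves T = nleaves L by rewrite -shL nleaves_shape.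
pose M := (nleaves L).+1.
have labM : all (fun a => 0 < a < M)%N (leaves L).
  by apply/allP => a /lab; rewrite nT.
(* Both sides count the forest maps with quotients at most [k]. *)
transitivity ((forest_maps M true L 1 (k.+1 * M))%:R : K).
  rewrite (forest_maps_spine_poly charK (X := k.+1)) //; last first.
    move=> b bL _ x; have /andP[_ bM] := allP labM b bL.
    by rewrite -[(k.+1 * M)%N]addn0 ltn_lex // addn0.
  rewrite shL; congr (_ * _).
  (* The exponents $r_T+1$ and $r_T-1$ have the same parity; positivity rules out truncation. *)
  have := right_leaves_gt0 T; rewrite /right_leaves.
  by case: (right_leaves_from _ _) => // r _; rewrite addn1 !exprS !mulN1r opprK.
congr (_%:R); rewrite forest_maps_removal_words //; apply: eq_big_seq => w.
rewrite mem_removal_words => /andP[/eqP sw wP].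
have [_ sub _] := removal_word_labels uL wP.
(* A fictitious previous value 0, with quotient and letter 0, starts the chain. *)
rewrite -[X in chains _ _ X]/((0 * M + 0).+1)%N chains_binomial // ?sw ?add0n ?nT //.
by apply/allP => a /sub /(allP labM) /andP[].
Qed.
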